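(* Let $\mathbb{F}_q$ be a finite field and $1\le r\le q-1$. Consider $(k,D)$-regular instances of $\text{max-E}k\text{-LINSAT}(q,r)$ with $m$ constraints and $n$ variables, so that $n/m = k/D$. Let $p=\ell/m\in[0,1-1/q]$ be a normalized decoding radius satisfying the classical rate condition $$\Bigl(1-\frac{n}{m}\Bigr)\log_2 q \;\le\; C_q(p).$$ Then, as $n/m=k/D\to 0$, the approximation ratio $\alpha_{\mathrm{DQI}}(p)$ of decoded quantum interferometry with a classical decoder satisfies $$\alpha_{\mathrm{DQI}}(p)\;\le\; \frac{r}{q}+\mathcal{O}_{q,r}\!\left(\sqrt{\frac{n/m}{\log(m/n)}}\right),$$ where the implied constant depends only on $q$ and $r$. In particular, for fixed $k$ and $D\to\infty$, $\alpha_{\mathrm{DQI}}(p)\le r/q+\mathcal{O}\bigl(1/\sqrt{D\log D}\bigr)$.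
   Context: An instance of $\text{max-E}k\text{-LINSAT}(q,r)$ consists of a matrix $B\in\mathbb{F}_q^{m\times n}$ with exactly $k$ nonzero entries in each row and sets $F_i\subset\mathbb{F}_q$ with $|F_i|=r$; constraint $i$ is $\sum_j B_{i,j}x_j\in F_i$. It is $(k,D)$-regular if moreover each column of $B$ has exactly $D$ nonzero entries, so $km=Dn$. The dual code $C^\perp=\ker(B^T)\subseteq\mathbb{F}_q^m$ has rate $1-\operatorname{rank}(B)/m\ge 1-n/m$. Decoded quantum interferometry (DQI) uses a decoder for $C^\perp$; $\ell$ denotes its asymptotic decoding radius, i.e. the maximum number of random errors in $C^\perp$ that the decoder can reliably correct. The approximation ratio of DQI (fraction of satisfied constraints) is taken to be given by the semicircle law: with $p=\ell/m$, $$\alpha_{\mathrm{DQI}}(p)=\left(\sqrt{p\Bigl(1-\frac rq\Bigr)}+\sqrt{\frac rq(1-p)}\right)^{2}\ \text{ if } \frac rq\le 1-p,\qquad \alpha_{\mathrm{DQI}}(p)=1\ \text{ otherwise.}$$ For a classical decoder the relevant channel is the $q$-ary symmetric channel with error probability $p$, of Shannon capacity (in bits) $C_q(p)=\log_2 q-H_q(p)$, where $H_q(p)=-p\log_2 p-(1-p)\log_2(1-p)+p\log_2(q-1)$. Reliable decoding requires the code rate (in bits per symbol) not to exceed the capacity, which gives the rate condition in the claim. *)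

(* Defs.v *)
From HB Require Import structures.
From mathcomp Require Import all_boot all_order all_algebra.
From mathcomp Require Import all_classical all_reals all_analysis.

Set Implicit Arguments.
Unset Strict Implicit.
Unset Printing Implicit Defensive.

Import Order.TTheory GRing.Theory Num.Theory.
Local Open Scope ring_scope.

(* An instance of max-Ek-LINSAT(q, r) with m constraints in n variables, where
   q = #|F|: constraint i is  \sum_j coef I i j * x j \in target I i. *)
Record linsat (F : finFieldType) (k r m n : nat) := Linsat {
  coef : 'M[F]_(m, n);
  target : 'I_m -> {set F};
  row_weight : forall i, #|[set j | coef i j != 0]| = k;
  card_target : forall i, #|target i| = r
}.

(* (k, D)-regularity; the row condition is already part of [linsat]. *)
Definition regular (F : finFieldType) (k r m n D : nat)
    (I : linsat F k r m n) : Prop :=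
  forall j, #|[set i | coef I i j != 0]| = D.

Section Formulas.
Variable R : realType.

(* As [ln 0 = 0], the convention 0 * log2 0 = 0 holds in [entropy], i.e. H_q(p). *)
Definition log2 (x : R) : R := ln x / ln 2.

Definition entropy (q : nat) (p : R) : R :=
  - p * log2 p - (1 - p) * log2 (1 - p) + p * log2 (q%:R - 1).

(* C_q(p), the capacity in bits of the q-ary symmetric channel *)
Definition capacity (q : nat) (p : R) : R := log2 q%:R - entropy q p.

(* The semicircle law *)
Definition alpha_DQI (q r : nat) (p : R) : R :=
  let rho := r%:R / q%:R in
  if rho <= 1 - p
  then (Num.sqrt (p * (1 - rho)) + Num.sqrt (rho * (1 - p))) ^+ 2
  else 1.

(* The rate condition, with the lower bound 1 - n/m in place of the exact rate
   1 - rank(B)/m of the dual code. *)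
Definition rate_condition (q m n : nat) (p : R) : Prop :=
  (1 - n%:R / m%:R) * log2 q%:R <= capacity q p.

End Formulas.

(* Main.v *)
Require Import Defs.
From HB Require Import structures.
From mathcomp Require Import all_boot all_order all_algebra.
From mathcomp Require Import all_classical all_reals all_analysis.
From mathcomp Require Import ring lra zify.

Set Implicit Arguments.
Unset Strict Implicit.
Unset Printing Implicit Defensive.

Import Order.TTheory GRing.Theory Num.Theory.
Local Open Scope ring_scope.

(** The semicircle law gives [alpha <= rho + O(sqrt p)], so the claim reduces to
    [p = O(x / ln (1/x))] with [x = n/m].  The rate condition says
    [H_q(p) <= x log2 q], hence [- p ln p <= x ln q].  Since [p <= 1 - 1/q] forces
    [- ln p >= 1/q], a first crude bound is [p <= q x ln q]; feeding it back into
    [- ln p] yields [- ln p >= ln (1/x) / 2] once [x <= q^-4], which gives the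
    logarithmic gain. *)

(** Double counting of the nonzero entries of [coef I], by rows and by columns. *)
Lemma regular_double_count (F : finFieldType) (k r m n D : nat)
    (I : linsat F k r m n) : regular D I -> (k * m = D * n)%N.
Proof.
move=> regI.
have rows : (\sum_i \sum_j (coef I i j != 0%R))%N = (k * m)%N.
  rewrite (eq_bigr (fun=> k)) ?sum_nat_const ?card_ord 1?mulnC // => i _.
  by rewrite -[RHS](row_weight I i) -sum1dep_card [RHS]big_mkcond.
have cols : (\sum_j \sum_i (coef I i j != 0%R))%N = (D * n)%N.
  rewrite (eq_bigr (fun=> D)) ?sum_nat_const ?card_ord 1?mulnC // => j _.
  by rewrite -[RHS](regI j) -sum1dep_card [RHS]big_mkcond.
by rewrite -rows -cols exchange_big.
Qed.

Lemma regular_ratio (R : realType) (F : finFieldType) (k r m n D : nat)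
    (I : linsat F k r m n) : (0 < k)%N -> (0 < m)%N -> regular D I ->
  [/\ (0 < n)%N, (0 < D)%N & n%:R / m%:R = k%:R / D%:R :> R].
Proof.
move=> k0 m0 /regular_double_count e.
have : (0 < D * n)%N by rewrite -e muln_gt0 k0.
rewrite muln_gt0 => /andP[D0 n0]; split=> //.
apply/eqP; rewrite eqr_div ?pnatr_eq0 -?lt0n // -!natrM e.
by rewrite mulnC.
Qed.

Section Bounds.
Variable R : realType.
Implicit Types (p x : R) (q r : nat).

Lemma alpha_DQI_le q r p : (r < q)%N -> 0 <= p <= 1 ->
  alpha_DQI q r p <= r%:R / q%:R + (q%:R + 3) * Num.sqrt p.
Proof.
move=> ltrq /andP[p0 p1]; rewrite /alpha_DQI.
have q0 : 0 < q%:R :> R by rewrite ltr0n (leq_ltn_trans _ ltrq).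
have q1 : 1 <= q%:R :> R by rewrite ler1n (leq_ltn_trans _ ltrq).
set rho := r%:R / q%:R.
have rho0 : 0 <= rho by rewrite divr_ge0 ?ler0n.
(* Integrality of [r < q] keeps [rho] at distance at least 1/q from 1. *)
have rho1 : rho <= 1 - q%:R^-1.
  rewrite lerBrDr -[X in _ + X]mul1r -mulrDl ler_pdivrMr // mul1r.
  by rewrite natr1 ler_nat.
have qi : 0 < q%:R^-1 :> R by rewrite invr_gt0.
have ss : Num.sqrt p ^+ 2 = p by rewrite sqr_sqrtr.
have s0 := sqrtr_ge0 p.
have s1 : Num.sqrt p <= 1 by rewrite -sqrtr1 ler_wsqrtr.
have ps : p <= Num.sqrt p by nra.
case: ifPn => [_|].
  (* The squares contribute at most [rho + p] and the cross term at most [2 sqrt p]; with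
     [p <= sqrt p] this gives the constant 3. *)
  rewrite sqrrD !sqr_sqrtr ?mulr_ge0 ?subr_ge0 //; last by lra.
  have a1 : Num.sqrt (p * (1 - rho)) <= Num.sqrt p.
    by rewrite ler_wsqrtr // ler_piMr //; lra.
  have b1 : Num.sqrt (rho * (1 - p)) <= 1.
    by rewrite -[leRHS]sqrtr1 ler_wsqrtr //; nra.
  have := ler_pM (sqrtr_ge0 _) (sqrtr_ge0 _) a1 b1.
  by rewrite mulr1 mulr2n => ab; nra.
rewrite -ltNge => lt.
(* Here [sqrt p >= p > 1 - rho >= 1/q], so the term [q sqrt p] alone covers the value 1 of the
   saturated branch. *)
have : 1 <= q%:R * Num.sqrt p.
  by rewrite mulrC -ler_pdivrMr // div1r; lra.
by nra.
Qed.

Lemma rate_condition_entropy q m n p : (2 <= q)%N -> 0 <= p <= 1 ->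
  rate_condition q m n p -> - p * ln p <= n%:R / m%:R * ln q%:R.
Proof.
move=> q2 /andP[p0 p1].
rewrite /rate_condition /capacity /entropy /log2.
have l2 : 0 < ln 2 :> R by rewrite ln_gt0 // ltr1n.
have lq1 : 0 <= ln (q%:R - 1) :> R.
  have : 2 <= q%:R :> R by rewrite ler_nat.
  by move=> ?; rewrite ln_ge0 //; lra.
have l1p : ln (1 - p) <= 0 by rewrite ln_le0 //; lra.
rewrite -(ler_pM2r l2).
set A := ln q%:R; set x := n%:R / m%:R.
have -> : (1 - x) * (A / ln 2) * ln 2 = (1 - x) * A.
  by field; rewrite gt_eqF.
rewrite [leRHS](_ : _ = A - (- p * ln p - (1 - p) * ln (1 - p)
   + p * ln (q%:R - 1))); last by field; rewrite gt_eqF.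
have : 0 <= p * ln (q%:R - 1) by exact: mulr_ge0.
have : (1 - p) * ln (1 - p) <= 0 by rewrite mulr_ge0_le0 //; lra.
lra.
Qed.

Lemma entropy_inversion q p x : (2 <= q)%N -> 0 < x -> x <= (q ^ 4)%:R^-1 ->
  0 <= p <= 1 - 1 / q%:R -> - p * ln p <= x * ln q%:R ->
  p <= 2 * q%:R * (x / ln x^-1).
Proof.
move=> q2 x0 xq /andP[p0 pq] H.
have q0 : 0 < q%:R :> R by rewrite ltr0n (leq_trans _ q2).
have lnq0 : 0 < ln q%:R :> R by rewrite ln_gt0 // ltr1n.
have lnqq : ln q%:R <= q%:R :> R by have := ln_sublinear q0; lra.
(* The exponent 4 makes [2 ln q], the loss in the crude bound below, at most half of [ln (1/x)]. *)
have lx : 4 * ln q%:R <= ln x^-1.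
  rewrite mulr_natl -lnXn // -natrX ler_ln ?posrE ?invr_gt0 //.
    by rewrite -[leLHS]invrK lef_pV2 // posrE invr_gt0 ltr0n expn_gt0 (leq_trans _ q2).
  by rewrite ltr0n expn_gt0 (leq_trans _ q2).
have lx0 : 0 < ln x^-1 by lra.
(* The case [p = 0] is separate: there [ln p] has the default value 0, and [ln p <= - 1/q] fails. *)
have [->|pn0] := eqVneq p 0.
  by rewrite !mulr_ge0 ?invr_ge0 ?ltW.
have pp : 0 < p by rewrite lt_neqAle eq_sym pn0.
have lp : ln p <= - q%:R^-1.
  have : ln (1 + (p - 1)) <= p - 1 by apply: le_ln1Dx; lra.
  by rewrite addrC subrK; lra.
(* Chain: [p / q <= - p ln p <= x ln q <= x q]. *)
have crude : p <= q%:R ^+ 2 * x.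
  have : p * q%:R^-1 <= x * ln q%:R by nra.
  rewrite ler_pdivrMr // => h; apply: (le_trans h).
  by nra.
(* Taking logarithms, [ln p <= 2 ln q - ln (1/x) <= - ln (1/x) / 2]. *)
have half : ln x^-1 / 2 <= - ln p.
  have : ln p <= ln (q%:R ^+ 2 * x) by rewrite ler_ln ?posrE // mulr_gt0 ?exprn_gt0.
  rewrite lnM ?posrE ?exprn_gt0 // lnXn // mulr2n.
  have := lnV x0; lra.
rewrite mulrA ler_pdivlMr //.
by nra.
Qed.

(** Quantitative core of both asymptotic claims: the threshold [q^-4] and the constant depend on [q]
    alone. *)
Lemma alpha_DQI_rate_bound q r m n p : (1 <= r <= q - 1)%N ->
  (0 < n)%N -> (0 < m)%N -> n%:R / m%:R <= (q ^ 4)%:R^-1 :> R ->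
  0 <= p <= 1 - 1 / q%:R -> rate_condition q m n p ->
  alpha_DQI q r p <= r%:R / q%:R + (q%:R + 3) * Num.sqrt (2 * q%:R) *
    Num.sqrt (n%:R / m%:R / ln (m%:R / n%:R)).
Proof.
move=> hr n0 m0 xq pq rate.
have q2 : (2 <= q)%N by lia.
have p01 : 0 <= p <= 1.
  case/andP: pq => -> pq /=; apply: (le_trans pq).
  by rewrite gerBl divr_ge0.
apply: le_trans (alpha_DQI_le _ p01) _; first by lia.
rewrite lerD2l -mulrA ler_wpM2l ?addr_ge0 // -sqrtrM ?mulr_ge0 //.
rewrite ler_wsqrtr // -[m%:R / n%:R]invf_div.
apply: entropy_inversion => //; first by rewrite divr_gt0 ?ltr0n.
exact: rate_condition_entropy.
Qed.

End Bounds.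

Theorem mainTheorem4 (R : realType) (q r : nat)
    (hr : (1 <= r <= q - 1)%N) :
  (exists C eps : R, 0 < eps /\
    forall (F : finFieldType) (k D m n : nat) (I : linsat F k r m n),
      #|F| = q -> (0 < k)%N -> (0 < m)%N -> regular D I ->
      n%:R / m%:R = k%:R / D%:R :> R /\
      (n%:R / m%:R <= eps ->
       forall l : R, let p := l / m%:R in
         0 <= p <= 1 - 1 / q%:R -> rate_condition q m n p ->
         alpha_DQI q r p <=
           r%:R / q%:R + C * Num.sqrt ((n%:R / m%:R) / ln (m%:R / n%:R))))
  /\
  (forall k : nat, (0 < k)%N ->
    exists (C : R) (D0 : nat),
    forall (F : finFieldType) (D m n : nat) (I : linsat F k r m n),
      #|F| = q -> (0 < m)%N -> regular D I -> (D0 <= D)%N ->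
      forall l : R, let p := l / m%:R in
        0 <= p <= 1 - 1 / q%:R -> rate_condition q m n p ->
        alpha_DQI q r p <=
          r%:R / q%:R + C / Num.sqrt (D%:R * ln D%:R)).
Proof.
have q0 : (0 < q)%N by lia.
pose C : R := (q%:R + 3) * Num.sqrt (2 * q%:R).
have C0 : 0 <= C by rewrite mulr_ge0 ?addr_ge0 ?sqrtr_ge0.
split.
  exists C, (q ^ 4)%:R^-1; split; first by rewrite invr_gt0 ltr0n expn_gt0 q0.
  move=> F k D m n I cF k0 m0 regI.
  have [n0 D0 e] := regular_ratio R k0 m0 regI.
  split=> // xq l p pq rate.
  exact: alpha_DQI_rate_bound.
(* The threshold gives both [D >= k q^4], so that [k/D <= q^-4], and [D >= k^2], so that
   [ln (D/k) >= ln D / 2]; this halving produces the 2 in [sqrt (2 k)]. *)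
move=> k k0; exists (C * Num.sqrt (2 * k%:R)), (k ^ 2 * q ^ 4)%N.
move=> F D m n I cF m0 regI leD l p pq rate.
have [n0 D0 e] := regular_ratio R k0 m0 regI.
have k1 : 0 < k%:R :> R by rewrite ltr0n.
have D1 : 0 < D%:R :> R by rewrite ltr0n.
have kD : (k ^ 2 <= D)%N.
  by apply: leq_trans leD; rewrite leq_pmulr // expn_gt0 q0.
have kqD : (k * q ^ 4 <= D)%N.
  by apply: leq_trans leD; rewrite leq_mul2r leq_pmulr ?orbT.
(* Since [q >= 2], this forces [D > 1] and hence [ln D > 0]. *)
have q4 : (2 ^ 4 <= q ^ 4)%N by rewrite leq_exp2r //; lia.
have lnD : 0 < ln D%:R :> R by rewrite ln_gt0 // ltr1n; nia.
have xq : n%:R / m%:R <= (q ^ 4)%:R^-1 :> R.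
  by rewrite e ler_pdivrMr // mulrC ler_pdivlMr ?ltr0n ?expn_gt0 ?q0 // -natrM ler_nat.
apply: (le_trans (alpha_DQI_rate_bound hr n0 m0 xq pq rate)).
have DlnD : 0 <= D%:R * ln D%:R :> R by rewrite ltW ?mulr_gt0.
rewrite lerD2l -/C -[leRHS]mulrA ler_wpM2l // -sqrtrV //.
rewrite -sqrtrM ?mulr_ge0 // ler_wsqrtr //.
rewrite -[m%:R / n%:R]invf_div e invf_div.
have lnk : ln D%:R / 2 <= ln (D%:R / k%:R) :> R.
  have : ln (k%:R ^+ 2) <= ln D%:R :> R.
    by rewrite ler_ln ?posrE ?exprn_gt0 // -natrX ler_nat.
  by rewrite lnXn // ln_div ?posrE // mulr2n; lra.
have -> : 2 * k%:R * (D%:R * ln D%:R)^-1 = k%:R / D%:R * (ln D%:R / 2)^-1 :> R.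
  by field; rewrite !gt_eqF.
rewrite ler_wpM2l ?divr_ge0 // lef_pV2 ?posrE //; lra.
Qed.
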